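(* Every (finite or infinite) non-increasing sequence $S$ of positive integers is realizable; that is, for every such sequence $S$ there exists a finite simple connected graph that realizes $S$.
   Context: All graphs are finite, simple and connected. Given a proper coloring of a graph $G$, a vertex $v$ is a color-dominating vertex (CDV) if its closed neighborhood $N[v]$ contains all colors used in the coloring. A b-coloring is a proper coloring in which every color class contains at least one CDV. A ''sequence'' is a non-increasing (finite or infinite) sequence of positive integers; finite sequences $(s_1,\dots,s_k)$ have length $k\ge 1$. A graph $G$ realizes a finite sequence $(s_1,\dots,s_k)$ if $G$ has a b-coloring with $k$ colors in which, for each $i\in\{1,\dots,k\}$, the $i$th color class contains at least $s_i$ CDVs. A graph $G$ realizes an infinite sequence $(s_1,s_2,\dots)$ if it realizes $(s_1,\dots,s_k)$ for at least one integer $k$. A sequence is realizable if some graph realizes it.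
   Formalization: Finite sequences of length one are restricted to (1): a sequence (s_1) with s_1 ≥ 2 is not realizable, since a connected graph properly colored with one color is a single vertex and has only one CDV. *)

(* Defs.v *)
From mathcomp Require Import all_boot.
Set Implicit Arguments.
Unset Strict Implicit.
Unset Printing Implicit Defensive.

Record sgraph := SGraph {
  vertex :> finType;
  edge : rel vertex;
  edge_sym : symmetric edge;
  edge_irrefl : irreflexive edge }.

Definition connected_graph (G : sgraph) : Prop :=
  0 < #|G| /\ forall x y : G, connect (@edge G) x y.

Definition closed_nbhd (G : sgraph) (v : G) : {set G} :=
  [set u | (u == v) || edge v u].

Definition proper_coloring (G : sgraph) (k : nat) (c : G -> 'I_k) : Prop :=
  forall u v : G, edge u v -> c u != c v.

(* The colors used in the coloring are the values actually taken by [c]. *)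
Definition cdv (G : sgraph) (k : nat) (c : G -> 'I_k) (v : G) : bool :=
  [set c u | u in G] \subset [set c u | u in closed_nbhd v].

Definition cdv_class (G : sgraph) (k : nat) (c : G -> 'I_k) (i : 'I_k) :
    {set G} :=
  [set v | (c v == i) && cdv c v].

(* As [i] ranges over all of ['I_k], this also says that all [k] colors are
   used. *)
Definition b_coloring (G : sgraph) (k : nat) (c : G -> 'I_k) : Prop :=
  proper_coloring c /\ forall i : 'I_k, exists v : G, v \in cdv_class c i.

(* Terms are indexed from 0. *)
Inductive fiseq :=
  | FinSeq of seq nat
  | InfSeq of (nat -> nat).

Definition is_sequence (S : fiseq) : Prop :=
  match S with
  | FinSeq s =>
      [/\ 0 < size s, forall x, x \in s -> 0 < x & sorted geq s]
  | InfSeq f =>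
      (forall n, 0 < f n) /\ (forall n, f n.+1 <= f n)
  end.

Definition realizes_finite (G : sgraph) (s : seq nat) : Prop :=
  exists c : G -> 'I_(size s),
    b_coloring c /\ forall i : 'I_(size s), nth 0 s i <= #|cdv_class c i|.

Definition realizes (G : sgraph) (S : fiseq) : Prop :=
  match S with
  | FinSeq s => realizes_finite G s
  | InfSeq f => exists k : nat, 0 < k /\ realizes_finite G (mkseq f k)
  end.

Definition realizable (S : fiseq) : Prop :=
  exists G : sgraph, connected_graph G /\ realizes G S.

(* A connected graph with a proper coloring in one color is a single vertex, so
   a one-term sequence with term at least 2 has no connected realization. *)
Lemma singleton_realizable (s : nat) : realizable (FinSeq [:: s]) -> s <= 1.
Proof.
case=> G [[_ conn] [c [[prop _] /(_ ord0) /= le_s]]].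
apply: leq_trans le_s (leq_trans (max_card _) _).
apply/card_le1P => x _ y; rewrite !inE; symmetry; apply/eqP.
have /connectP[[|z p] /= xp ->] := conn x y; first by [].
by case/andP: xp => /prop; rewrite (ord1 (c x)) (ord1 (c z)).
Qed.

(* Main.v *)
Require Import Defs.
From mathcomp Require Import all_boot.

(** In a complete multipartite graph colored by its parts, every vertex is
    color-dominating, so parts that are as large as the largest term of the
    sequence suffice; connectedness only needs two parts. For an infinite
    sequence it is enough to realize its first two terms. *)

Section CompleteMultipartite.

Variables k m : nat.

Definition multipartite_edge : rel ('I_k * 'I_m) := [rel u v | u.1 != v.1].

Lemma multipartite_edge_sym : symmetric multipartite_edge.
Proof. by move=> u v; rewrite /multipartite_edge /= eq_sym. Qed.

Lemma multipartite_edge_irrefl : irreflexive multipartite_edge.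
Proof. by move=> u; rewrite /multipartite_edge /= eqxx. Qed.

Definition multipartite : sgraph :=
  SGraph multipartite_edge_sym multipartite_edge_irrefl.

Definition part (v : multipartite) : 'I_k := v.1.

(** The color of [v] is borne by [v] itself; any other color is borne by a vertex in another part,
    hence by a neighbor of [v]. *)
Lemma multipartite_cdv (v : multipartite) : cdv part v.
Proof.
apply/subsetP => i /imsetP[u _ ->]; apply/imsetP.
have [uv | neq_uv] := eqVneq (part u) (part v).
  by exists v; rewrite // inE eqxx.
by exists u; rewrite // inE /= /multipartite_edge /= [v.1 == u.1]eq_sym neq_uv orbT.
Qed.

Lemma card_cdv_class_multipartite (i : 'I_k) : #|cdv_class part i| = m.
Proof.
have -> : cdv_class part i = setX [set i] setT.
  by apply/setP => -[j a]; rewrite !inE multipartite_cdv.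
by rewrite cardsX cards1 cardsT card_ord mul1n.
Qed.

Lemma multipartite_b_coloring : 0 < m -> b_coloring part.
Proof.
(* Properness holds by computation: an edge is by definition a difference of parts. *)
move=> m_gt0; split=> [u v // | i]; apply/card_gt0P.
by rewrite card_cdv_class_multipartite.
Qed.

Lemma multipartite_connected : 1 < k -> 0 < m -> connected_graph multipartite.
Proof.
move=> k_gt1 m_gt0; split; first by rewrite card_prod !card_ord muln_gt0 ltnW.
move=> u v; have [uv | neq_uv] := eqVneq u.1 v.1; last exact: connect1.
(* Two vertices of the same part are joined by a path of length 2 through another part [j], which
   exists since [1 < k]. *)
have /card_gt0P[j] : 0 < #|[set~ u.1]|.
  by rewrite cardsC1 card_ord -ltnS prednK // ltnW.
rewrite !inE => neq_ju.
apply: (@connect_trans _ _ (j, u.2)); apply: connect1 => /=.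
  by rewrite /multipartite_edge /= eq_sym.
by rewrite /multipartite_edge /= -uv.
Qed.

End CompleteMultipartite.

Lemma multipartite_realizes (s : seq nat) (m : nat) :
    0 < m -> (forall x, x \in s -> x <= m) ->
  realizes_finite (multipartite (size s) m) s.
Proof.
move=> m_gt0 le_m; exists (@part _ _); split=> [|i].
  exact: multipartite_b_coloring.
by rewrite card_cdv_class_multipartite le_m // mem_nth.
Qed.

Lemma connected_realizes_finite (s : seq nat) :
    1 < size s ->
  exists G : sgraph, connected_graph G /\ realizes_finite G s.
Proof.
(* The successor makes the part size positive whatever the terms are. *)
move=> s_gt1; pose m := (\max_(x <- s) x).+1.
exists (multipartite (size s) m); split; first exact: multipartite_connected.
apply: multipartite_realizes => // x s_x.
by apply: leqW; exact: (@leq_bigmax_seq _ _ xpredT id).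
Qed.

Theorem theorem3p2 (S : fiseq) (HS : is_sequence S)
    (Hsingle : forall s : nat, S = FinSeq [:: s] -> s = 1) :
  realizable S.
Proof.
case: S HS Hsingle => [s [s_gt0 _ _] single | f _ _].
  have [s_gt1 | s_le1] := ltnP 1 (size s); first exact: connected_realizes_finite.
  (* Only one-term sequences remain; [single] forces the term to be 1, and a single vertex realizes
     it. *)
  case: s s_gt0 s_le1 single => [|x []] // _ _ /(_ _ erefl) ->.
  exists (multipartite 1 1); split.
    split=> [|[i a] [j b]]; first by rewrite card_prod !card_ord.
    by rewrite (ord1 i) (ord1 j) (ord1 a) (ord1 b) connect0.
  by apply: (@multipartite_realizes [:: 1]) => // y; rewrite inE => /eqP->.
have [G [connG realG]] := @connected_realizes_finite (mkseq f 2) isT.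
by exists G; split=> //; exists 2.
Qed.
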